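(* Let $n,d\ge1$. For each $r\in\{0,1,2,\dots\}$ the cone $\mathcal{O}_{n,d}^{(r)}$ contains the copositive cone $\mathcal{C}_{n,d}$; more precisely $$\mathcal{O}_{n,d}^{(0)}\supseteq\mathcal{O}_{n,d}^{(1)}\supseteq\cdots\supseteq\mathcal{C}_{n,d},\qquad\text{and}\qquad \mathcal{C}_{n,d}=\bigcap_{r\in\mathbb{N}}\mathcal{O}_{n,d}^{(r)}.$$
   Context: $\mathcal{S}_{n,d}$ is the real vector space of symmetric tensors of order $d$ and dimension $n$ (real arrays invariant under permutations of indices), $\langle\mathcal{A},\mathcal{B}\rangle=\sum_{i_1,\dots,i_d}a_{i_1\cdots i_d}b_{i_1\cdots i_d}$ and $\mathcal{T}_d(\mathbf{x})=\mathbf{x}\otimes\cdots\otimes\mathbf{x}$ ($d$ factors). The copositive cone is $\mathcal{C}_{n,d}=\{\mathcal{A}\in\mathcal{S}_{n,d}:\langle\mathcal{A},\mathcal{T}_d(\mathbf{x})\rangle\ge0\ \forall\mathbf{x}\in\mathbb{R}^n_+\}$. $\Delta=\{\mathbf{x}\in\mathbb{R}^n_+:\|\mathbf{x}\|_1=1\}$ is the standard simplex and $\mathbb{N}_0=\{0,1,2,\dots\}$. For $r\in\mathbb{N}_0$, $\Delta_n^{(r)}=\{\mathbf{x}\in\Delta:(r+2)\mathbf{x}\in\mathbb{N}_0^n\}$ and $\delta_n^{(r)}=\bigcup_{k=1}^{r}\Delta_n^{(k)}$ (empty union for $r=0$). $\mathcal{O}_{n,d}^{(r)}=\{\mathcal{A}\in\mathcal{S}_{n,d}:\langle\mathcal{A},\mathcal{T}_d(\mathbf{v})\rangle\ge0\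 \forall\mathbf{v}\in\delta_n^{(r)}\}$. *)

(* Defs.v *)
From mathcomp Require Import all_boot all_order all_fingroup all_algebra.
From mathcomp Require Import boolp classical_sets reals.

Import Order.TTheory GRing.Theory Num.Theory.
Local Open Scope classical_set_scope.
Local Open Scope ring_scope.

(* Arrays (a_{i_1 ... i_d}), where the multi-index (i_1, ..., i_d) is a finite
   function from 'I_d to 'I_n. *)
Definition tensor (R : realType) (n d : nat) :=
  {ffun {ffun 'I_d -> 'I_n} -> R}.

Definition symmetric_tensors (R : realType) (n d : nat) : set (tensor R n d) :=
  [set A | forall (s : 'S_d) (i : {ffun 'I_d -> 'I_n}),
             A [ffun k => i (s k)] = A i].

Definition tensor_inner {R : realType} {n d : nat} (A B : tensor R n d) : R :=
  \sum_(i : {ffun 'I_d -> 'I_n}) A i * B i.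

Definition tensor_power {R : realType} {n : nat} (d : nat) (x : 'rV[R]_n) :
    tensor R n d :=
  [ffun i : {ffun 'I_d -> 'I_n} => \prod_(k < d) x 0 (i k)].

Definition nonneg_orthant (R : realType) (n : nat) : set 'rV[R]_n :=
  [set x | forall i, 0 <= x 0 i].

Definition copositive_cone (R : realType) (n d : nat) : set (tensor R n d) :=
  [set A | symmetric_tensors R n d A /\
           forall x : 'rV[R]_n, nonneg_orthant R n x ->
             0 <= tensor_inner A (tensor_power d x)].

(* The library norm on row vectors is the sup norm, hence an
   explicit 1-norm. *)
Definition norm1 {R : realType} {n : nat} (x : 'rV[R]_n) : R :=
  \sum_(i < n) `|x 0 i|.

Definition std_simplex (R : realType) (n : nat) : set 'rV[R]_n :=
  [set x | nonneg_orthant R n x /\ norm1 x = 1].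

Definition simplex_grid (R : realType) (n r : nat) : set 'rV[R]_n :=
  [set x | std_simplex R n x /\
           forall i, ((r + 2)%:R *: x) 0 i \is a Num.nat].

Definition simplex_grids (R : realType) (n r : nat) : set 'rV[R]_n :=
  \bigcup_(k in [set k : nat | (1 <= k <= r)%N]) simplex_grid R n k.

Definition outer_cone (R : realType) (n d r : nat) : set (tensor R n d) :=
  [set A | symmetric_tensors R n d A /\
           forall v : 'rV[R]_n, simplex_grids R n r v ->
             0 <= tensor_inner A (tensor_power d v)].

(* Main.v *)
Require Import Defs.
From mathcomp Require Import all_boot all_order all_fingroup all_algebra.
From mathcomp Require Import boolp classical_sets reals.
From mathcomp Require Import functions topology normedtype sequences.

Import Order.TTheory GRing.Theory Num.Theory.
Import numFieldNormedType.Exports.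

(* The form [x |-> <A, x^{(x)d}>] is homogeneous, and clearing denominators turns
   every nonzero nonnegative rational vector into a positive multiple of a grid
   point. So membership of A in all outer cones makes the form nonnegative on
   nonnegative rational vectors, hence by continuity on the whole orthant. *)

Local Open Scope classical_set_scope.
Local Open Scope ring_scope.

Lemma tensor_inner_powerZ (R : realType) (n d : nat) (A : tensor R n d)
    (c : R) (x : 'rV[R]_n) :
  tensor_inner A (tensor_power d (c *: x)) =
  c ^+ d * tensor_inner A (tensor_power d x).
Proof.
rewrite /tensor_inner mulr_sumr; apply: eq_bigr => i _.
rewrite mulrCA; congr (_ * _); rewrite !ffunE.
under eq_bigr do rewrite mxE.
by rewrite big_split/= prodr_const card_ord.
Qed.

(** The form is a polynomial in the coordinates, a finite sum of finite products, so coordinatewise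
    convergence is enough. *)
Lemma cvg_tensor_inner_power (R : realType) (n d : nat) (A : tensor R n d)
    (y : nat -> 'rV[R]_n) (x : 'rV[R]_n) :
  (forall i, y N 0 i @[N --> \oo] --> x 0 i) ->
  tensor_inner A (tensor_power d (y N)) @[N --> \oo] -->
  tensor_inner A (tensor_power d x).
Proof.
move=> yx; rewrite /tensor_inner.
apply: cvg_big; first exact: add_continuous.
move=> i _; apply: cvgM; first exact: cvg_cst.
rewrite ffunE; under eq_fun do rewrite ffunE.
apply: cvg_big; first exact: mul_continuous.
by move=> k _; exact: yx.
Qed.

(** Truncation loses less than 1, so the ratio lies between [t - 1/(N+1)] and [t]. *)
Lemma cvg_truncn_ratio (R : realType) (t : R) : 0 <= t ->
  N.+1%:R^-1 * (Num.truncn (N.+1%:R * t))%:R @[N --> \oo] --> t.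
Proof.
move=> t0; apply: (@squeeze_cvgr _ _ _ _ (fun N => t - harmonic N) (cst t)).
- near=> N; have N0 : 0 < N.+1%:R :> R by rewrite ltr0n.
  have /andP[lo up] := truncn_itv (mulr_ge0 (ltW N0) t0).
  rewrite /cst ler_pdivrMl// lo andbT /harmonic ler_pdivlMl// mulrBr divff ?gt_eqF//.
  by rewrite lerBlDr natr1 ltW.
- rewrite -[X in _ --> X]subr0; apply: cvgB; [exact: cvg_cst|exact: cvg_harmonic].
- exact: cvg_cst.
Unshelve. all: by end_near. Qed.

Lemma tensor_inner_power_nat_ge0 (R : realType) (n d : nat) (A : tensor R n d)
    (m : 'I_n -> nat) : (0 < d)%N ->
  (forall r, (1 <= r)%N -> outer_cone R n d r A) ->
  0 <= tensor_inner A (tensor_power d (\row_i (m i)%:R)).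
Proof.
move=> d0 AO; set x := \row_i _.
(* The zero vector cannot be normalised to the simplex; there the form vanishes by homogeneity, as
   [0 ^+ d = 0] for [0 < d]. *)
have [s0|s_gt0] := posnP (\sum_i m i)%N.
  have -> : x = 0 *: x.
    rewrite scale0r; apply/rowP => i; rewrite !mxE; apply/eqP.
    by rewrite pnatr_eq0 -leqn0 -s0 (bigD1 i)//= leq_addr.
  by rewrite tensor_inner_powerZ expr0n gtn_eqF// mul0r.
(* Tripling guarantees a denominator [r + 2] with [1 <= r]. *)
set s := (3 * \sum_i m i)%N.
have s3 : (3 <= s)%N by rewrite leq_pmulr.
have sN0 : s%:R != 0 :> R by rewrite pnatr_eq0 -lt0n (leq_trans _ s3).
(* As [s] is three times the 1-norm of [x], the vector [(3 / s%:R) *: x] is [x] normalised to the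
   simplex, and [s] times it is the integer vector [3 *: x]. *)
have xE : x = (s%:R / 3) *: ((3 / s%:R) *: x).
  by rewrite scalerA mulrA divfK ?pnatr_eq0// divff// scale1r.
rewrite xE tensor_inner_powerZ mulr_ge0 ?exprn_ge0 ?divr_ge0//.
(* The grid of index [s - 2] has denominator [s]. *)
have r1 : (1 <= s - 2)%N by rewrite leq_subRL ?(leq_trans _ s3).
apply: (AO _ r1).2; exists (s - 2)%N; first by rewrite /= r1 leqnn.
have x0 i : 0 <= ((3 / s%:R) *: x) 0 i by rewrite !mxE mulr_ge0 ?divr_ge0.
split; last first.
  move=> i; rewrite subnK ?(leq_trans _ s3)// scalerA mulrC divfK//.
  by rewrite !mxE -natrM natr_nat.
split=> //; rewrite /Defs.norm1.
under eq_bigr => i _ do rewrite ger0_norm// !mxE.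
by rewrite -mulr_sumr -natr_sum mulrAC -natrM divff//.
Qed.

Lemma copositive_cone_sub_outer (R : realType) (n d r : nat) :
  copositive_cone R n d `<=` outer_cone R n d r.
Proof. by move=> A [sA cA]; split=> // v [k _ [[v0 _] _]]; exact: cA. Qed.

Lemma outer_cone_bigcap_sub (R : realType) (n d : nat) : (0 < d)%N ->
  \bigcap_(r in [set r : nat | (1 <= r)%N]) outer_cone R n d r `<=`
  copositive_cone R n d.
Proof.
move=> d0 A AO; split; first by have [] := AO 1%N isT.
move=> x x0.
(* Rounding down to multiples of [1/(N+1)] keeps the coordinates nonnegative and gives rational
   vectors [y N] tending to [x]. *)
pose m N i := Num.truncn (N.+1%:R * x 0 i).
pose y N : 'rV[R]_n := N.+1%:R^-1 *: \row_i (m N i)%:R.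
have y_cvg : tensor_inner A (tensor_power d (y N)) @[N --> \oo] -->
             tensor_inner A (tensor_power d x).
  apply: cvg_tensor_inner_power => i.
  under eq_fun do rewrite !mxE.
  exact: cvg_truncn_ratio.
apply: (cvgr_to_ge y_cvg); apply: nearW => N.
rewrite tensor_inner_powerZ mulr_ge0 ?exprn_ge0 ?invr_ge0//.
exact: tensor_inner_power_nat_ge0.
Qed.

Theorem theorem8 (R : realType) (n d : nat) (hn : (1 <= n)%N) (hd : (1 <= d)%N) :
  [/\ forall r : nat, copositive_cone R n d `<=` outer_cone R n d r,
      forall r : nat, outer_cone R n d r.+1 `<=` outer_cone R n d r
    & copositive_cone R n d =
      \bigcap_(r in [set r : nat | (1 <= r)%N]) outer_cone R n d r].
Proof.
split.
- by move=> r; exact: copositive_cone_sub_outer.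
(* Being a union over all indices up to [r], the test set grows with [r], even though single grids
   need not be nested. *)
- move=> r A [sA oA]; split=> // v [k /= /andP[k1 kr] vk].
  by apply: oA; exists k => //=; rewrite k1 leqW.
- apply/seteqP; split; last exact: outer_cone_bigcap_sub.
  by move=> A cA r _; exact: copositive_cone_sub_outer.
Qed.
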